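(* The couple $(\ell^p,\ell^q)$, with $0\le p<q<1$, does not have the uniform Calderón–Mityagin property.
   Context: All sequences are real. For $0<p<\infty$, $\|x\|_{\ell^p}=(\sum_k|x_k|^p)^{1/p}$; $\ell^0$ is the linear space of eventually zero sequences with $\|x\|_{\ell^0}:=\mathrm{card}\{k:x_k\ne0\}$. Put $\|T\|_{X\to X}:=\sup_{x\ne0}\|Tx\|_X/\|x\|_X$. For $0\le p<q$ (so $\ell^p\subset\ell^q$), $\mathfrak{L}(\ell^p,\ell^q)$ is the set of bounded linear operators $T$ on $\ell^q$ whose restriction to $\ell^p$ is a bounded map of $\ell^p$ into itself, and $\|T\|_{\mathfrak{L}(\ell^p,\ell^q)}:=\max(\|T\|_{\ell^p\to\ell^p},\|T\|_{\ell^q\to\ell^q})$. For $x\in\ell^q$ and $t>0$, $\mathcal{K}(t,x;\ell^p,\ell^q):=\inf\{\|x_0\|_{\ell^p}+t\|x_1\|_{\ell^q}:x=x_0+x_1,\ x_0\in\ell^p,\ x_1\in\ell^q\}$. For $x\neq 0$, $\mathcal{K}\text{-}\mathrm{Orb}(x;\ell^p,\ell^q)$ is the set of $y\in\ell^q$ with $\|y\|_{\mathcal{K}\text{-}\mathrm{Orb}(x)}:=\sup_{t>0}\mathcal{K}(t,y;\ell^p,\ell^q)/\mathcal{K}(t,x;\ell^p,\ell^q)<\infty$. The couple has the uniform Calderón–Mityagin property if for every nonzero $x\in\ell^q$ and every $y\in\mathcal{K}\text{-}\mathrm{Orb}(x;\ell^p,\ell^q)$ there is $T\in\mathfrak{L}(\ell^p,\ell^q)$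 with $y=Tx$ and, additionally, there is a constant $C$ independent of $x,y$ such that $T$ can be chosen with $\|T\|_{\mathfrak{L}(\ell^p,\ell^q)}\le C\|y\|_{\mathcal{K}\text{-}\mathrm{Orb}(x)}$ (for $p>0$); by homogeneity this is equivalent to requiring that whenever $\mathcal{K}(t,y;\ell^p,\ell^q)\le\mathcal{K}(t,x;\ell^p,\ell^q)$ for all $t>0$, there is $T$ with $Tx=y$ and $\|T\|_{\mathfrak{L}(\ell^p,\ell^q)}\le C$. For $p=0$, where $\|\cdot\|_{\ell^0}$ is not homogeneous, the additional requirement is taken in this last (normalized) form. *)

(* Defs.v *)
From mathcomp Require Import all_boot all_order all_algebra.
From mathcomp Require Import all_classical all_reals all_analysis.

Set Implicit Arguments.
Unset Strict Implicit.
Unset Printing Implicit Defensive.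

Import Order.TTheory GRing.Theory Num.Theory.
Import numFieldNormedType.Exports.

Local Open Scope classical_set_scope.
Local Open Scope ring_scope.

(* All quantities below are extended reals. The case [r = 0] is separated
   because [Lnorm _ 0] is not the cardinality of the support. *)
Definition ell_norm (R : realType) (r : R) (x : nat -> R) : \bar R :=
  if r == 0 then counting [set k | x k != 0]
  else Lnorm counting r%:E (EFin \o x).

Definition ell (R : realType) (r : R) : set (nat -> R) :=
  if r == 0 then [set x | \forall k \near \oo, x k = 0]
  else [set x | (ell_norm r x < +oo)%E].

(* An operator on l^r is represented by a total function on sequences, whose
   values outside l^r are irrelevant. *)
Definition linear_on (R : realType) (r : R) (T : (nat -> R) -> (nat -> R)) :
    Prop :=
  forall (a : R) (x y : nat -> R), ell r x -> ell r y ->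
    T (a *: x + y) = a *: T x + T y.

Definition opnorm (R : realType) (r : R) (T : (nat -> R) -> (nat -> R)) :
    \bar R :=
  ereal_sup [set (ell_norm r (T x) / ell_norm r x)%E |
             x in [set x | ell r x /\ x <> 0]].

Definition bounded_on (R : realType) (r : R) (T : (nat -> R) -> (nat -> R)) :
    Prop :=
  (forall x, ell r x -> ell r (T x)) /\ (opnorm r T < +oo)%E.

Definition couple_op (R : realType) (p q : R) :
    set ((nat -> R) -> (nat -> R)) :=
  [set T | [/\ linear_on q T, bounded_on q T & bounded_on p T]].

Definition couple_opnorm (R : realType) (p q : R)
    (T : (nat -> R) -> (nat -> R)) : \bar R :=
  Order.max (opnorm p T) (opnorm q T).

Definition Kfun (R : realType) (p q t : R) (x : nat -> R) : \bar R :=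
  ereal_inf [set (ell_norm p u.1 + t%:E * ell_norm q u.2)%E |
             u in [set u : (nat -> R) * (nat -> R) |
                   [/\ x = u.1 + u.2, ell p u.1 & ell q u.2]]].

Definition Korb_norm (R : realType) (p q : R) (x y : nat -> R) : \bar R :=
  ereal_sup [set (Kfun p q t y / Kfun p q t x)%E | t in [set t : R | 0 < t]].

Definition Korb (R : realType) (p q : R) (x : nat -> R) : set (nat -> R) :=
  [set y | ell q y /\ (Korb_norm p q x y < +oo)%E].

Definition Calderon_Mityagin (R : realType) (p q : R) : Prop :=
  forall x y : nat -> R, ell q x -> x <> 0 -> Korb p q x y ->
    exists T, couple_op p q T /\ T x = y.

Definition uniform_bound (R : realType) (p q : R) : Prop :=
  exists C : R, forall x y : nat -> R,
    ell q x -> x <> 0 -> Korb p q x y ->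
    exists T, [/\ couple_op p q T, T x = y &
      (couple_opnorm p q T <= C%:E * Korb_norm p q x y)%E].

Definition normalized_uniform_bound (R : realType) (p q : R) : Prop :=
  exists C : R, forall x y : nat -> R,
    ell q x -> x <> 0 -> ell q y ->
    (forall t : R, 0 < t -> (Kfun p q t y <= Kfun p q t x)%E) ->
    exists T, [/\ couple_op p q T, T x = y &
      (couple_opnorm p q T <= C%:E)%E].

(* The l^0 functional is not homogeneous, so for [p = 0] the uniformity
   requirement is imposed in its normalized form. *)
Definition uniform_Calderon_Mityagin (R : realType) (p q : R) : Prop :=
  Calderon_Mityagin p q /\
  (if p == 0 then normalized_uniform_bound p q else uniform_bound p q).

(* Main.v *)
Require Import Defs.
From mathcomp Require Import all_boot all_order all_algebra.
From mathcomp Require Import all_classical all_reals all_analysis.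
From mathcomp Require Import lra.
Import Order.TTheory GRing.Theory Num.Theory.
Local Open Scope ring_scope.

(** For [q < 1] a bounded operator on l^q cannot gather a spread-out sequence
    into one entry without losing l^q norm: [n] unit entries have norm
    [n^(1/q)], but their images add up to an entry of size [O(n)] only.  The
    K-functional does not see this obstruction.  Take the block
    [x = 1_{[0, 2m)}] and the spike [y = a e_0] with [a = m^(1/q) / 2], whose
    l^q norm is that of [x] up to a constant factor.

    The spike is dominated by the block: [K(t, y) <= K(t, x)] for every
    [t > 0].  In a decomposition [x = u + v] each of the [2m] unit entries
    leaves at least [1/2] to [u] or to [v], so one of them has [m] entries of
    modulus at least [1/2].  If it is [v], then [t ||v||_q >= t a], which is
    the cost of [y = 0 + y]; if it is [u], then
    [||u||_p >= m^(1/p) / 2 >= a] (or [||u||_0 >= m >= 1] when [p = 0]), which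
    is the cost of [y = y + 0].  This is [Kfun_spike_le_block].

    On the other hand, if [T] is linear with norm at most [C] on l^q, every
    coordinate of [T e_k] is at most [C], so the coordinates of [T x] are at
    most [2 m C] ([coord_op_block]).  Hence [T x = y] forces
    [m^(1/q) / 2 <= 2 m C], that is [m^(1/q - 1) <= 4 C], which fails for
    large [m] because [1/q - 1 > 0].

    The two forms of the uniformity requirement are reduced to the normalized
    one in [uniform_Calderon_MityaginW], so that [p = 0] and [p > 0] are
    refuted by the same pair [x, y]. *)

Section Sequences.
Local Open Scope classical_set_scope.
Context {R : realType}.
Implicit Types (p q r c t : R) (u v z : nat -> R) (A B : set nat).

(** * The functionals of l^r on multiples of indicators *)

Lemma counting_II n : counting (`I_n : set nat) = n%:R%:E :> \bar R.
Proof. by rewrite /counting asboolT// (card_fset_set (card_eqxx _)). Qed.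

Lemma counting_set1 k : counting ([set k] : set nat) = 1%:E :> \bar R.
Proof. by rewrite /counting asboolT// fset_set1 finmap.cardfs1. Qed.

Lemma scale_indicE c A k : (c *: (\1_A : nat -> R)) k = c * \1_A k.
Proof. by []. Qed.

Lemma norm_indic A k : `|\1_A k| = \1_A k :> R.
Proof. by rewrite ger0_norm// indicE ler0n. Qed.

Lemma ell_norm_ge0 r u : (0 <= ell_norm r u)%E.
Proof.
by rewrite /ell_norm; case: ifP => _; [exact: measure_ge0|exact: Lnorm_ge0].
Qed.

Lemma le_ell_norm r u v : 0 <= r -> (forall k, `|u k| <= `|v k|) ->
  (ell_norm r u <= ell_norm r v)%E.
Proof.
rewrite le_eqVlt => /predU1P[<-|r0] uv; rewrite /ell_norm.
  rewrite eqxx; apply: le_measure; rewrite ?inE// => k /=.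
  by rewrite -!normr_gt0 => /lt_le_trans; exact.
rewrite gt_eqF// !(@unlock _ _ locked_Lnorm)/=.
apply: gt0_ler_poweR; rewrite ?invr_ge0 ?(ltW r0)//.
- by rewrite in_itv/= leey andbT integral_ge0// => x _; exact: poweR_ge0.
- by rewrite in_itv/= leey andbT integral_ge0// => x _; exact: poweR_ge0.
apply: ge0_le_integral => //= k _; rewrite lee_fin.
by apply: ge0_ler_powR; rewrite ?nnegrE ?(ltW r0).
Qed.

(** The integrand is [|c|^r 1_A], which also holds off [A] because [0^r = 0]. *)
Lemma ell_norm_indic r c A : 0 < r ->
  ell_norm r (c *: (\1_A : nat -> R)) =
    (`|c|%:E * poweR (counting A) r^-1)%E.
Proof.
move=> r0; rewrite /ell_norm gt_eqF// (@unlock _ _ locked_Lnorm)/=.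
have -> : (\int[counting]_x (`|(c *: (\1_A : nat -> R)) x| `^ r)%:E =
    \int[counting]_x ((`|c| `^ r)%:E * (\1_A x)%:E))%E.
  apply: eq_integral => k _; rewrite -EFinM; congr (_%:E).
  rewrite normrM norm_indic powRM// ?indicE ?ler0n//.
  by case: (_ \in _); rewrite ?powR1// powR0// gt_eqF.
rewrite ge0_integralZl_EFin ?powR_ge0//.
rewrite integral_indic// setIT poweRM ?lee_fin ?powR_ge0//.
by rewrite poweR_EFin -powRrM divff ?gt_eqF// powRr1.
Qed.

Lemma ell_norm_spike r c k : 0 < r ->
  ell_norm r (c *: (\1_[set k] : nat -> R)) = `|c|%:E.
Proof. by move=> r0; rewrite ell_norm_indic// counting_set1 poweR1r mule1. Qed.

(** A sequence dominates the spike carrying any one of its entries. *)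
Lemma coord_le_ell_norm r u k : 0 < r -> (`|u k|%:E <= ell_norm r u)%E.
Proof.
move=> r0; rewrite -(ell_norm_spike r (u k) k r0).
apply: le_ell_norm; first exact: ltW.
move=> j; rewrite scale_indicE normrM norm_indic indicE.
case: (boolP (j \in [set k])); rewrite ?mulr0//.
by rewrite inE => ->; rewrite mulr1.
Qed.

Lemma ell_finite_support r c A n : 0 <= r -> A `<=` `I_n ->
  ell r (c *: (\1_A : nat -> R)).
Proof.
rewrite le_eqVlt => /predU1P[<-|r0] An; rewrite /ell.
  rewrite eqxx; exists n => // k /= nk.
  rewrite scale_indicE indicE memNset ?mulr0//.
  by move=> /An /=; rewrite ltnNge nk.
rewrite gt_eqF//= ell_norm_indic// /counting asboolT ?poweR_EFin ?ltry//.
exact: sub_finite_set (finite_II n).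
Qed.

(** Chebyshev's inequality, obtained by comparing [u] with [c 1_A]. *)
Lemma ell_norm_large r c A u (m : nat) : 0 < r -> 0 <= c ->
    (forall k, A k -> c <= `|u k|) -> (m%:R%:E <= (counting A : \bar R))%E ->
  ((c * m%:R `^ r^-1)%:E <= ell_norm r u)%E.
Proof.
move=> r0 c0 Au mA.
apply: (@le_trans _ _ (ell_norm r (c *: (\1_A : nat -> R)))); last first.
  apply: le_ell_norm; first exact: ltW.
  move=> k; rewrite scale_indicE normrM norm_indic indicE ger0_norm//.
  by case: (boolP (k \in A)); rewrite ?mulr0 ?mulr1// inE => /Au.
rewrite ell_norm_indic// ger0_norm// EFinM lee_wpmul2l// -poweR_EFin.
apply: gt0_ler_poweR; rewrite ?invr_ge0 ?(ltW r0)// in_itv/= leey andbT//.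
Qed.

Lemma ell_indic r A n : 0 <= r -> A `<=` `I_n -> ell r (\1_A : nat -> R).
Proof. by move=> r0 /(ell_finite_support r 1 A n r0); rewrite scale1r. Qed.

Lemma ell0 r : 0 <= r -> ell r (0 : nat -> R).
Proof.
move=> r0; rewrite -(scale0r (\1_(set0 : set nat) : nat -> R)).
exact: (ell_finite_support r 0 set0 0 r0).
Qed.

Lemma ell_norm0 r : 0 <= r -> ell_norm r (0 : nat -> R) = 0%E.
Proof.
rewrite le_eqVlt => /predU1P[<-|r0].
  rewrite /ell_norm eqxx (_ : [set k | _] = set0) ?measure0//.
  by apply/seteqP; split => k //=; rewrite eqxx.
by rewrite -(scale0r (\1_[set 0%N] : nat -> R)) ell_norm_spike// normr0.
Qed.

(** * The K-functional of a spike and of a block *)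

Lemma Kfun_ge0 p q t u : 0 <= t -> (0 <= Kfun p q t u)%E.
Proof.
move=> t0; apply: le_ereal_inf_tmp => _ [w _ <-].
by rewrite adde_ge0 ?mule_ge0 ?lee_fin ?ell_norm_ge0.
Qed.

Lemma Kfun_le_p p q t u : 0 <= q -> ell p u ->
  (Kfun p q t u <= ell_norm p u)%E.
Proof.
move=> q0 pu; apply: ereal_inf_lbound; exists (u, 0) => /=.
  by split; [rewrite addr0|exact: pu|exact: ell0].
by rewrite ell_norm0// mule0 adde0.
Qed.

Lemma Kfun_le_q p q t u : 0 <= p -> ell q u ->
  (Kfun p q t u <= t%:E * ell_norm q u)%E.
Proof.
move=> p0 qu; apply: ereal_inf_lbound; exists (0, u) => /=.
  by split; [rewrite add0r|exact: ell0|exact: qu].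
by rewrite ell_norm0// add0e.
Qed.

(** In each of the [2m] places where [u + v = 1], one summand is at least [1/2]
    in modulus, so the two sets below cover the block. *)
Lemma block_splitting u v m :
  u + v = \1_(`I_(m.*2)) ->
  (m%:R%:E <= counting [set k | (2^-1 <= `|u k|)%R] :> \bar R)%E \/
  (m%:R%:E <= counting [set k | (2^-1 <= `|v k|)%R] :> \bar R)%E.
Proof.
move=> uv; set A := [set k | _]; set B := [set k | _].
have AB : `I_(m.*2) `<=` A `|` B.
  move=> k km; have : (u + v) k = 1 by rewrite uv indicE mem_set.
  rewrite /A /B/= fctE => uv1.
  case: (lerP 2^-1 `|u k|) => [|uk]; [by left|right].
  have := ler_normD (u k) (v k); rewrite uv1 normr1; lra.
have : ((m.*2)%:R%:E <= counting A + counting B :> \bar R)%E.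
  rewrite -counting_II; apply: le_trans (measureU2 _ _ _) => //.
  by apply: le_measure; rewrite ?inE.
case: (leP m%:R%:E (counting A : \bar R)) => [|Am mAB]; [by left|right].
rewrite leNgt; apply/negP => Bm.
have := le_lt_trans mAB (lteD Am Bm).
by rewrite -EFinD -natrD addnn ltxx.
Qed.

(** The spike is decomposed trivially, as [y + 0] or as [0 + y] according to
    which part of the given decomposition of the block is large.  The exponent
    [1/q] suits both cases: if [p > 0], then [m^(1/q) <= m^(1/p)] as [m >= 1]. *)
Lemma Kfun_spike_le_block p q t m : 0 <= p -> p < q -> 0 <= t -> (0 < m)%N ->
  (Kfun p q t ((2^-1 * m%:R `^ q^-1)%R *: (\1_[set 0%N] : nat -> R))
    <= Kfun p q t (\1_(`I_(m.*2)) : nat -> R))%E.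
Proof.
move=> p0 pq t0 m0; set a := _ * _; set y := _ *: _.
have q0 : 0 < q := le_lt_trans p0 pq.
have m1 : 1 <= m%:R :> R by rewrite ler1n.
have a0 : 0 <= a by rewrite mulr_ge0 ?powR_ge0.
have yell r : 0 <= r -> ell r y.
  by move=> r0; apply: (ell_finite_support r a _ 1 r0) => k /= ->.
apply: le_ereal_inf_tmp => _ [[u v] /= [xuv _ _] <-].
have [Am|Bm] := block_splitting u v m (esym xuv).
- apply: le_trans (Kfun_le_p p q t y (ltW q0) (yell p p0)) _.
  apply: (@le_trans _ _ (ell_norm p u)); last first.
    by rewrite leeDl// mule_ge0 ?lee_fin ?ell_norm_ge0.
  move: p0; rewrite le_eqVlt => /predU1P[p_eq0|p0].
    (* On l^0 the spike has norm at most 1, whatever its height. *)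
    rewrite -p_eq0 /ell_norm eqxx.
    apply: (@le_trans _ _ (counting [set 0%N] : \bar R)).
      apply: le_measure; rewrite ?inE// => k /=.
      rewrite /y scale_indicE indicE.
      case: (boolP (k \in [set 0%N])); rewrite ?inE// => _.
      by rewrite mulr0 eqxx.
    rewrite counting_set1.
    apply: (@le_trans _ _ m%:R%:E); first by rewrite lee_fin.
    apply: (le_trans Am); apply: le_measure; rewrite ?inE// => k /= uk.
    by rewrite -normr_gt0; apply: lt_le_trans uk.
  rewrite ell_norm_spike// ger0_norm//.
  apply: le_trans (ell_norm_large p 2^-1 _ u m p0 _ (fun=> id) Am) => //.
  by rewrite lee_fin ler_wpM2l// ler_powR// lef_pV2 ?posrE// ltW.
- apply: le_trans (Kfun_le_q p q t y p0 (yell q (ltW q0))) _.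
  apply: (@le_trans _ _ (t%:E * ell_norm q v)%E); last first.
    by rewrite leeDr ?ell_norm_ge0.
  rewrite lee_wpmul2l ?lee_fin// ell_norm_spike// ger0_norm//.
  exact: (ell_norm_large q 2^-1 _ v m q0 _ (fun=> id) Bm).
Qed.

(** An entry [u k <> 0] has a half of its modulus left in one of the two parts.
    Positivity makes the quotients in the K-orbit norm meaningful. *)
Lemma Kfun_gt0 p q t u : 0 < p -> 0 < q -> 0 < t -> u <> 0 ->
  (0 < Kfun p q t u)%E.
Proof.
move=> p0 q0 t0 u0.
have [k /eqP uk] : exists k, u k <> 0.
  by apply/existsNP => h; apply: u0; apply/funext.
have uk0 : 0 < `|u k| by rewrite normr_gt0.
apply: (@lt_le_trans _ _ (Num.min (`|u k| / 2) (t * (`|u k| / 2)))%:E).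
  by rewrite lte_fin lt_min !(mulr_gt0, divr_gt0).
apply: le_ereal_inf_tmp => _ [[v w] /= [uvw _ _] <-].
have vw : `|u k| / 2 <= `|v k| \/ `|u k| / 2 <= `|w k|.
  case: (lerP (`|u k| / 2) `|v k|) => [|vk]; [by left|right].
  have := ler_normD (v k) (w k); rewrite (_ : v k + w k = u k); first lra.
  by rewrite uvw.
case: vw => h.
- apply: (@le_trans _ _ (ell_norm p v)); last first.
    by rewrite leeDl// mule_ge0 ?lee_fin ?ell_norm_ge0// ltW.
  apply: le_trans (coord_le_ell_norm p v k p0).
  by rewrite lee_fin ge_min h.
- apply: (@le_trans _ _ (t%:E * ell_norm q w)%E); last first.
    by rewrite leeDr ?ell_norm_ge0.
  apply: (@le_trans _ _ (t%:E * `|w k|%:E)%E).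
    by rewrite -EFinM lee_fin ge_min ler_pM2l// h orbT.
  by rewrite lee_wpmul2l ?lee_fin ?(ltW t0)// coord_le_ell_norm.
Qed.

(** * Operators on blocks and the normalization of the uniform bound *)

(** The norm of l^q is not subadditive for [q < 1], so the triangle inequality
    is applied to the [j]-th entries of the sequences [T e_k] instead, each of
    which is bounded by [||T e_k||_q <= C]. *)
Lemma coord_op_block q T C n j : 0 < q -> linear_on q T ->
  (opnorm q T <= C%:E)%E -> `|T (\1_(`I_n) : nat -> R) j| <= n%:R * C.
Proof.
move=> q0 Tlin TC; elim: n => [|n IH].
  have /(_ (-1) 0 0 (ell0 q (ltW q0)) (ell0 q (ltW q0))) := Tlin.
  rewrite !scaleN1r oppr0 addr0 addNr mul0r => T0.
  by rewrite II0 indic0 T0 normr0.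
have IE : 1 *: (\1_[set n] : nat -> R) + (\1_(`I_n) : nat -> R) =
    \1_(`I_n.+1).
  apply/funext => k; rewrite scale1r fctE !indicE -natrD; congr (_%:R).
  have mem_II i : (k \in `I_i) = (k < i)%N by apply/idP/idP; rewrite inE.
  have -> : (k \in [set n]) = (k == n).
    by apply/idP/eqP => [|->]; rewrite inE.
  by rewrite !mem_II ltnS; case: ltngtP.
have e_ell : ell q (\1_[set n] : nat -> R).
  by apply: (ell_indic q _ n.+1 (ltW q0)) => k /= ->.
rewrite -IE Tlin//; last exact: (ell_indic q _ n (ltW q0)).
rewrite scale1r fctE -natr1 mulrDl mul1r addrC.
apply: le_trans (ler_normD _ _) _.
apply: lerD; first exact: IH.
rewrite -lee_fin; apply: le_trans TC.
apply: le_trans (coord_le_ell_norm q _ j q0) _.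
apply: ereal_sup_ubound; exists (\1_[set n] : nat -> R).
  split=> // /(congr1 (@^~ n)); rewrite indicE mem_set//= => /eqP.
  by rewrite oner_eq0.
rewrite -{2}(scale1r (\1_[set n] : nat -> R)) ell_norm_spike// normr1.
by rewrite inve1 mule1.
Qed.

(** If [K(t, y) <= K(t, x)] for all [t > 0], the norm of [y] in the orbit of [x]
    is at most 1; taking the absolute value of the constant makes its product
    with that norm monotone in the norm. *)
Lemma uniform_Calderon_MityaginW p q : 0 <= p -> 0 < q ->
  uniform_Calderon_Mityagin (R:=R) p q -> normalized_uniform_bound (R:=R) p q.
Proof.
move=> p0 q0 [_]; case: ifPn => // p_neq0 [C CP].
have {}p0 : 0 < p by rewrite lt_neqAle eq_sym p_neq0.
exists `|C| => x y xell x0 yell Kyx.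
have Korb_le1 : (Korb_norm p q x y <= 1)%E.
  apply: ge_ereal_sup => _ [t /= t0 <-].
  have Kx0 : (0 < Kfun p q t x)%E by exact: Kfun_gt0.
  apply: (@le_trans _ _ (Kfun p q t x / Kfun p q t x)%E).
    by rewrite lee_wpmul2r ?inve_ge0 ?(ltW Kx0)//; exact: Kyx.
  (* The quotient of an infinite value by itself is 0. *)
  have [->|Kxoo] := eqVneq (Kfun p q t x) +oo%E; first by rewrite invey mule0.
  by rewrite divee ?gt_eqF// ge0_fin_numE ?lt_neqAle ?Kxoo ?leey// ltW.
have Korb_ge0 : (0 <= Korb_norm p q x y)%E.
  apply: (@le_trans _ _ (Kfun p q 1 y / Kfun p q 1 x)%E).
    by rewrite mule_ge0 ?inve_ge0 ?Kfun_ge0.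
  by apply: ereal_sup_ubound; exists 1 => //=.
have xy_orb : Korb p q x y by split=> //; exact: le_lt_trans Korb_le1 (ltry _).
have [T [Top Txy TC]] := CP x y xell x0 xy_orb.
exists T; split=> //; apply: (le_trans TC).
apply: (@le_trans _ _ (`|C|%:E * Korb_norm p q x y)%E).
  by rewrite lee_wpmul2r ?lee_fin ?ler_norm.
by rewrite -[leRHS]mule1 lee_wpmul2l.
Qed.

End Sequences.

Theorem theorem7p1 (R : realType) (p q : R)
  (p_ge0 : 0 <= p) (p_lt_q : p < q) (q_lt1 : q < 1) :
  ~ uniform_Calderon_Mityagin p q.
Proof.
have q0 : 0 < q := le_lt_trans p_ge0 p_lt_q.
move=> /(uniform_Calderon_MityaginW p q p_ge0 q0) [C CP].
pose s := q^-1 - 1; have s0 : 0 < s by rewrite subr_gt0 invf_gt1.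
(* [D] is the solution of [D^s = 4 |C|], so [m > D] violates the bound. *)
pose D := (4 * `|C|) `^ s^-1; pose m := (Num.truncn D).+1.
have Dm : D < m%:R by exact: truncnS_gt.
pose x : nat -> R := \1_(`I_(m.*2)).
pose y : nat -> R := (2^-1 * m%:R `^ q^-1) *: (\1_[set 0%N] : nat -> R).
have x_ell : ell q x by exact: (ell_indic q _ m.*2 (ltW q0)).
have x_neq0 : x <> 0.
  move=> /(congr1 (@^~ 0%N)); rewrite /x indicE mem_set//= => /eqP.
  by rewrite oner_eq0.
have y_ell : ell q y.
  by apply: (ell_finite_support q _ _ 1 (ltW q0)) => k /= ->.
have [t t0|T [[Tlin _ _] Txy]] := CP x y x_ell x_neq0 y_ell.
  exact: Kfun_spike_le_block (ltW t0) _.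
rewrite ge_max => /andP[_ TC].
have := coord_op_block q T C m.*2 0%N q0 Tlin TC.
rewrite -/x Txy /y scale_indicE indicE mem_set//= mulr1.
rewrite ger0_norm ?mulr_ge0 ?powR_ge0//.
have -> : q^-1 = s + 1 by rewrite subrK.
rewrite powRD ?powRr1//; last by rewrite pnatr_eq0 implybT.
have Cm : 4 * `|C| < m%:R `^ s.
  have -> : 4 * `|C| = D `^ s.
    by rewrite -powRrM mulVf ?gt_eqF// powRr1// mulr_ge0.
  by apply: gt0_ltr_powR; rewrite ?nnegrE ?powR_ge0.
apply/negP; rewrite -ltNge -muln2 natrM mulrA -(mulrA _ 2) (mulrC m%:R).
rewrite ltr_pM2r ?ltr0n//.
have := ler_norm C; lra.
Qed.
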